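(* Let $n$ be a positive integer and let $\mathbb{Z}/2$ act on $\mathbb{Z}/n$ by $x\mapsto -x$. If $n\not\equiv 0 \mod 4$, then $$i_*: H_\bullet^{\mathbb{Z}/2}(\mathbb{Z}/n;\mathbb{Z})\longrightarrow H_\bullet(\mathbb{Z}/n;\mathbb{Z})^{\mathbb{Z}/2}$$ is an isomorphism.
   Context: For a finite group $Q$ acting on a group $G$ by automorphisms, $C_\bullet(G)$ is the (unnormalized) bar complex: $C_i(G)$ is the free abelian group on symbols $[g_1|\cdots|g_i]$ with $g_j\in G$, with boundary $d[g_1|\cdots|g_i]=[g_2|\cdots|g_i]+\sum_{k=1}^{i-1}(-1)^k[g_1|\cdots|g_kg_{k+1}|\cdots|g_i]+(-1)^i[g_1|\cdots|g_{i-1}]$. $Q$ acts on it by $q[g_1|\cdots|g_i]=[q(g_1)|\cdots|q(g_i)]$, and $C_\bullet(G)^Q$ is the subcomplex of $Q$-invariant chains. $H_\bullet^Q(G;\mathbb{Z})$ is the homology of $C_\bullet(G)^Q$. $H_\bullet(G;\mathbb{Z})$ is ordinary group homology with its induced $Q$-action, and $H_\bullet(G;\mathbb{Z})^Q$ is its subgroup of invariant classes. The map $i_*$ is induced by the inclusion $C_\bullet(G)^Q\to C_\bullet(G)$; its image lies in $H_\bullet(G;\mathbb{Z})^Q$. *)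

(* Defs.v *)
From HB Require Import structures.
From mathcomp Require Import all_boot all_order all_fingroup all_algebra.
From mathcomp Require Import generic_quotient ring_quotient.
From mathcomp Require Import boolp zify.

Set Implicit Arguments.
Unset Strict Implicit.
Unset Printing Implicit Defensive.

Import GRing.Theory.
Local Open Scope ring_scope.
Local Open Scope quotient_scope.

(* Chain complexes of abelian groups in nonnegative degrees; the differential
   out of degree 0 is zero and is left implicit, see [is_cycle]. *)
Record chain_complex := ChainComplex {
  chain :> nat -> zmodType;
  bd : forall i, {additive chain i.+1 -> chain i};
  bd_bd : forall i (c : chain i.+2), bd i (bd i.+1 c) = 0
}.
Arguments bd : clear implicits.

Record chain_map (X Y : chain_complex) := ChainMap {
  chain_fun :> forall i, {additive X i -> Y i};
  chain_fun_bd : forall i (c : X i.+1),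
    chain_fun i (bd X i c) = bd Y i (chain_fun i.+1 c)
}.

Section Homology.
Variables (X : chain_complex) (i : nat).

Definition is_cycle : {pred X i} :=
  match i return {pred X i} with
  | 0 => fun=> true
  | j.+1 => fun c => bd X j c == 0
  end.

Fact is_cycle_zmod_closed : zmod_closed is_cycle.
Proof.
rewrite /is_cycle; case: i => [|j]; first by split.
split=> [|x y]; rewrite !unfold_in ?raddf0 //.
by move=> /eqP xE /eqP yE; rewrite raddfB xE yE subrr.
Qed.
HB.instance Definition _ := GRing.isZmodClosed.Build (X i) is_cycle
  is_cycle_zmod_closed.

Record cycles := Cycle { cycle_val : X i; cycle_valP : cycle_val \in is_cycle }.

HB.instance Definition _ := [isSub for cycle_val].
HB.instance Definition _ := [Choice of cycles by <:].
HB.instance Definition _ := [SubChoice_isSubZmodule of cycles by <:].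

Definition is_boundary : {pred cycles} :=
  fun z => `[< exists b : X i.+1, bd X i b = cycle_val z >].

Fact is_boundary_zmod_closed : zmod_closed is_boundary.
Proof.
split; first by apply/asboolP; exists 0; rewrite raddf0.
move=> x y /asboolP[b bE] /asboolP[c cE].
by apply/asboolP; exists (b - c); rewrite raddfB bE cE.
Qed.
HB.instance Definition _ := GRing.isZmodClosed.Build cycles is_boundary
  is_boundary_zmod_closed.

Definition homology : zmodType := Quotient.quot is_boundary.

Definition homology_class (z : cycles) : homology := \pi_(Quotient.quot is_boundary) z.

Lemma homology_class_eq (z w : cycles) :
  homology_class z = homology_class w <->
  exists b : X i.+1, bd X i b = cycle_val z - cycle_val w.
Proof.
split=> [/eqP|h]; rewrite /homology_class.
  by rewrite -Quotient.idealrBE => /asboolP.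
by apply/eqP; rewrite -Quotient.idealrBE; apply/asboolP.
Qed.

Fact homology_class_zmod_morphism : zmod_morphism homology_class.
Proof. by move=> z w; rewrite /homology_class !piE. Qed.
HB.instance Definition _ := GRing.isZmodMorphism.Build cycles homology
  homology_class homology_class_zmod_morphism.

End Homology.

Section HomologyMap.
Variables (X Y : chain_complex) (f : chain_map X Y) (i : nat).

Fact cycle_map_subproof (z : cycles X i) : f i (cycle_val z) \in @is_cycle Y i.
Proof.
case: z; case: i => [|j] z //= zP.
by rewrite unfold_in /= -chain_fun_bd (eqP zP) raddf0.
Qed.

Definition cycle_map (z : cycles X i) : cycles Y i := Cycle (cycle_map_subproof z).

Definition homology_map_fun (h : homology X i) : homology Y i :=
  homology_class (cycle_map (repr h)).

Lemma homology_map_class (z : cycles X i) :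
  homology_map_fun (homology_class z) = homology_class (cycle_map z).
Proof.
apply/homology_class_eq => /=.
have /homology_class_eq[b bE] : homology_class (repr (homology_class z)) = homology_class z.
  by rewrite /homology_class reprK.
by exists (f i.+1 b); rewrite -chain_fun_bd bE raddfB.
Qed.

Fact homology_map_zmod_morphism : zmod_morphism homology_map_fun.
Proof.
move=> h k; rewrite -[h]reprK -[k]reprK.
rewrite -!/(homology_class _) -raddfB !homology_map_class -raddfB.
by congr homology_class; apply: val_inj; rewrite /= !raddfB.
Qed.
HB.instance Definition _ := GRing.isZmodMorphism.Build
  (homology X i) (homology Y i) homology_map_fun homology_map_zmod_morphism.

Definition homology_map : {additive homology X i -> homology Y i} :=
  homology_map_fun.

End HomologyMap.

Section Invariants.
Variables (Q : finType) (V : zmodType) (a : Q -> {additive V -> V}).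

Definition is_invariant : {pred V} := fun v => [forall q, a q v == v].

Fact is_invariant_zmod_closed : zmod_closed is_invariant.
Proof.
split=> [|x y xE yE]; apply/forallP => q; first by rewrite raddf0.
by rewrite raddfB (eqP (forallP xE q)) (eqP (forallP yE q)).
Qed.
HB.instance Definition _ := GRing.isZmodClosed.Build V is_invariant
  is_invariant_zmod_closed.

Record invariants := Invariant {
  invariant_val : V;
  invariant_valP : invariant_val \in is_invariant }.

HB.instance Definition _ := [isSub for invariant_val].
HB.instance Definition _ := [Choice of invariants by <:].
HB.instance Definition _ := [SubChoice_isSubZmodule of invariants by <:].

End Invariants.

Section InvariantComplex.
Variables (Q : finType) (X : chain_complex) (a : Q -> chain_map X X).

Definition invariant_chain (i : nat) : zmodType := invariants (fun q => a q i).

Fact invariant_bd_subproof i (c : invariant_chain i.+1) :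
  bd X i (invariant_val c) \in is_invariant (fun q => a q i).
Proof.
case: c => c cE; apply/forallP => q /=.
by rewrite chain_fun_bd (eqP (forallP cE q)).
Qed.

Definition invariant_bd_fun i (c : invariant_chain i.+1) : invariant_chain i :=
  Invariant (invariant_bd_subproof c).

Fact invariant_bd_zmod_morphism i : zmod_morphism (@invariant_bd_fun i).
Proof. by move=> c e; apply: val_inj; rewrite /= !raddfB. Qed.
HB.instance Definition _ i := GRing.isZmodMorphism.Build
  (invariant_chain i.+1) (invariant_chain i) (@invariant_bd_fun i)
  (@invariant_bd_zmod_morphism i).

Fact invariant_bd_bd i (c : invariant_chain i.+2) :
  invariant_bd_fun (invariant_bd_fun c) = 0.
Proof. by apply: val_inj; rewrite /= bd_bd. Qed.

Definition invariant_complex : chain_complex :=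
  @ChainComplex invariant_chain (fun i => @invariant_bd_fun i) invariant_bd_bd.

Definition incl_fun i (c : invariant_complex i) : X i := invariant_val c.

Fact incl_zmod_morphism i : zmod_morphism (@incl_fun i).
Proof. by []. Qed.
HB.instance Definition _ i := GRing.isZmodMorphism.Build
  (invariant_complex i) (X i) (@incl_fun i) (@incl_zmod_morphism i).

Fact incl_bd i (c : invariant_complex i.+1) :
  incl_fun (bd invariant_complex i c) = bd X i (incl_fun c).
Proof. by []. Qed.

Definition incl : chain_map invariant_complex X :=
  @ChainMap invariant_complex X (fun i => @incl_fun i) incl_bd.

Definition invariant_homology (i : nat) : zmodType :=
  invariants (fun q => homology_map (a q) i).

Fact homology_incl_invariant i (h : homology invariant_complex i) :
  homology_map incl i h \in is_invariant (fun q => homology_map (a q) i).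
Proof.
rewrite -[h]reprK -/(homology_class _); apply/forallP => q.
rewrite /homology_map /= !homology_map_class; apply/eqP; congr homology_class.
apply: val_inj => /=; rewrite /incl_fun.
by case: (cycle_val _) => c /= cE; rewrite (eqP (forallP cE q)).
Qed.

Definition homology_incl_fun i (h : homology invariant_complex i) :
  invariant_homology i := Invariant (homology_incl_invariant h).

Fact homology_incl_zmod_morphism i : zmod_morphism (@homology_incl_fun i).
Proof. by move=> h k; apply: val_inj; rewrite /= raddfB. Qed.
HB.instance Definition _ i := GRing.isZmodMorphism.Build
  (homology invariant_complex i) (invariant_homology i)
  (@homology_incl_fun i) (@homology_incl_zmod_morphism i).

Definition homology_incl i :
  {additive homology invariant_complex i -> invariant_homology i} :=
  @homology_incl_fun i.

End InvariantComplex.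

(* The free abelian group on a finite set. *)
Section FreeAbelian.

Definition free_ab (T : finType) : zmodType := {ffun T -> int}.

Definition free_gen (T : finType) (t : T) : free_ab T :=
  [ffun u => (u == t)%:R].

Section Lift.
Variables (T : finType) (V : zmodType) (f : T -> V).

Definition free_lift_fun (c : free_ab T) : V := \sum_t f t *~ c t.

Fact free_lift_zmod_morphism : zmod_morphism free_lift_fun.
Proof.
move=> c e; rewrite /free_lift_fun -sumrB; apply: eq_bigr => t _.
by rewrite !ffunE mulrzBr.
Qed.
HB.instance Definition _ := GRing.isZmodMorphism.Build (free_ab T) V
  free_lift_fun free_lift_zmod_morphism.

Definition free_lift : {additive free_ab T -> V} := free_lift_fun.

Lemma free_lift_gen t : free_lift (free_gen t) = f t.
Proof.
rewrite /free_lift /= /free_lift_fun (bigD1 t) //= ffunE eqxx big1 ?addr0 //.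
by move=> u ut; rewrite ffunE (negPf ut).
Qed.
End Lift.

Lemma free_abE (T : finType) (c : free_ab T) : c = \sum_t free_gen t *~ c t.
Proof.
apply/ffunP => u; rewrite sum_ffunE (bigD1 u) //= big1 ?addr0.
  by rewrite ffunMzE ffunE eqxx intz.
by move=> t tu; rewrite ffunMzE ffunE eq_sym (negPf tu) mul0rz.
Qed.

Lemma free_ext (T : finType) (V : zmodType) (f g : {additive free_ab T -> V}) :
  (forall t, f (free_gen t) = g (free_gen t)) -> f =1 g.
Proof.
move=> fg c; rewrite [c]free_abE !raddf_sum; apply: eq_bigr => t _.
by rewrite !raddfMz fg.
Qed.

End FreeAbelian.

Section BarComplex.
Variable gT : finGroupType.

(* The k-th face of [t_0|...|t_i], for k = 0, ..., i+1: it drops t_0 if k = 0,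
   drops t_i if k = i+1, and replaces t_(k-1), t_k by their product if
   0 < k < i+1. *)
Definition bar_face i (t : i.+1.-tuple gT) (k : nat) : i.-tuple gT :=
  [tuple if (j.+1 < k)%N then nth 1%g t j
         else if j.+1 == k then (nth 1 t j * nth 1 t j.+1)%g
         else nth 1%g t j.+1 | j < i].

Lemma nth_bar_face i (t : i.+1.-tuple gT) k j : (j < i)%N ->
  nth 1%g (bar_face t k) j =
    if (j.+1 < k)%N then nth 1%g t j
    else if j.+1 == k then (nth 1 t j * nth 1 t j.+1)%g else nth 1%g t j.+1.
Proof. by move=> ji; rewrite -(tnth_nth _ _ (Ordinal ji)) tnth_mktuple. Qed.

Lemma bar_face0 i (t : i.+1.-tuple gT) : bar_face t 0 = [tuple of behead t].
Proof.
apply: eq_from_tnth => j; rewrite tnth_mktuple /=.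
by rewrite (tnth_nth 1%g) /= nth_behead.
Qed.

Lemma bar_face_last i (t : i.+1.-tuple gT) :
  bar_face t i.+1 = take i t :> seq gT.
Proof.
apply: (@eq_from_nth _ 1%g) => [|j]; rewrite size_tuple ?size_takel ?size_tuple //.
by move=> ji; rewrite nth_bar_face // nth_take // ltnS ji.
Qed.

Lemma bar_face_mul i (t : i.+1.-tuple gT) k : (0 < k < i.+1)%N ->
  bar_face t k =
    take k.-1 t ++ (nth 1 t k.-1 * nth 1 t k)%g :: drop k.+1 t :> seq gT.
Proof.
case: k => // k /=; rewrite ltnS => ki.
have sz : size (take k t) = k by rewrite size_takel // size_tuple; lia.
have szr : size (bar_face t k.+1) = i by rewrite size_tuple.
apply: (@eq_from_nth _ 1%g) => [|j]; rewrite szr.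
  by rewrite size_cat sz /= size_drop size_tuple; lia.
move=> ji; rewrite nth_bar_face // nth_cat sz ltnS eqSS.
case: ltngtP => [jk|kj|->]; first by rewrite nth_take.
  by rewrite -[(j - k)%N]prednK ?subn_gt0 //= nth_drop; congr nth; lia.
by rewrite subnn.
Qed.

Lemma bar_face_face i (t : i.+2.-tuple gT) (j k : nat) : (j < k)%N ->
  bar_face (bar_face t k) j = bar_face (bar_face t j) k.-1.
Proof.
case: k => // k; rewrite ltnS => jk /=.
apply: eq_from_tnth => p; rewrite !tnth_mktuple.
have lt_pi := ltn_ord p; have lt_pi' := ltnW lt_pi.
rewrite !nth_bar_face // !ltnS !eqSS.
move: (nat_of_ord p) (tval t) => {lt_pi lt_pi' t}p t.
move: jk.
case: (ltngtP p.+1 j) => pj; case: (ltngtP p.+1 k) => pk jk; try (exfalso; lia);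
  do ?[case: ltngtP => ?; try (exfalso; lia)]; rewrite ?mulgA //.
Qed.

Lemma alternating_sum0 (V : zmodType) (n : nat) (F : nat -> nat -> V) :
  (forall j k, (j < k)%N -> F k j = F j k.-1) ->
  \sum_(k < n.+1) \sum_(j < n) F k j *~ ((-1) ^+ k * (-1) ^+ j) = 0.
Proof.
move=> FE; elim: n => [|n IHn].
  by rewrite big1 // => k _; rewrite big_ord0.
rewrite big_ord_recr /=.
under eq_bigr => k _ do rewrite big_ord_recr /=.
rewrite big_split /= IHn add0r -big_split big1 //= => k _.
by rewrite (FE k n.+1) ?ltn_ord //= exprS mulN1r mulNr mulrNz mulrC subrr.
Qed.

Definition bar_bd_gen i (t : i.+1.-tuple gT) : free_ab (i.-tuple gT) :=
  \sum_(k < i.+2) free_gen (bar_face t k) *~ (-1) ^+ k.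

Definition bar_bd i :
  {additive free_ab (i.+1.-tuple gT) -> free_ab (i.-tuple gT)} :=
  free_lift (@bar_bd_gen i).

Fact bar_bd_bd i (c : free_ab (i.+2.-tuple gT)) : bar_bd i (bar_bd i.+1 c) = 0.
Proof.
have bdE m t : bar_bd m (free_gen t) = bar_bd_gen t by exact: free_lift_gen.
apply: (@free_ext _ _ (bar_bd i \o bar_bd i.+1 : {additive _ -> _}) \0) => t /=.
rewrite bdE raddf_sum.
rewrite -[RHS](@alternating_sum0 _ i.+2
  (fun k j => free_gen (bar_face (bar_face t k) j))); last first.
  by move=> j k jk; rewrite bar_face_face.
apply: eq_bigr => k _; rewrite raddfMz bdE /bar_bd_gen mulrz_suml.
by apply: eq_bigr => j _; rewrite -mulrzA mulrC.
Qed.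

Definition bar_complex : chain_complex := ChainComplex bar_bd_bd.

End BarComplex.

(* Library actions are right actions: [to x q] is the image of x under q.
   Invariants do not depend on the side. *)
Section BarAction.
Variables (gT qT : finGroupType) (to : groupAction [set: qT] [set: gT]).

Definition bar_act_fun (q : qT) i :
  {additive bar_complex gT i -> bar_complex gT i} :=
  free_lift (fun t : i.-tuple gT => free_gen [tuple of map (to^~ q) t]).

Fact bar_act_bd (q : qT) i (c : bar_complex gT i.+1) :
  bar_act_fun q i (bd (bar_complex gT) i c) =
  bd (bar_complex gT) i (bar_act_fun q i.+1 c).
Proof.
have toM x y : to (x * y)%g q = (to x q * to y q)%g by apply: gactM; rewrite inE.
have actE m t : bar_act_fun q m (free_gen t) = free_gen [tuple of map (to^~ q) t].
  exact: free_lift_gen.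
have bdE m (t : m.+1.-tuple gT) : bd (bar_complex gT) m (free_gen t) = bar_bd_gen t.
  exact: free_lift_gen.
apply: (@free_ext _ _
  (bar_act_fun q i \o bd (bar_complex gT) i : {additive _ -> _})
  (bd (bar_complex gT) i \o bar_act_fun q i.+1 : {additive _ -> _})) => t /=.
rewrite actE !bdE raddf_sum.
apply: eq_bigr => k _; rewrite raddfMz actE.
congr (free_gen _ *~ _); apply: eq_from_tnth => j.
rewrite tnth_map !tnth_mktuple.
have jS : (j < i)%N := ltn_ord j.
have nthE p : (p < i.+1)%N ->
    nth 1%g (tval [tuple of map (to^~ q) t]) p = to (nth 1%g t p) q.
  by move=> lt_p; rewrite (nth_map 1%g) // size_tuple.
rewrite !nthE //; last exact: ltnW.
by case: ifP => _ //; case: ifP => _ //; rewrite toM.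
Qed.

Definition bar_act (q : qT) : chain_map (bar_complex gT) (bar_complex gT) :=
  ChainMap (bar_act_bd q).

Definition bar_incl_star i :
  {additive homology (invariant_complex bar_act) i ->
            invariant_homology bar_act i} := homology_incl bar_act i.

End BarAction.

(* Z/n for n > 0.  The library's 'Z_n is Z/2 when n = 1. *)
Definition Zmod (n : nat) : finGroupType := 'I_n.-1.+1.

Section NegationAction.
Variable n : nat.

Definition neg_act (x : Zmod n) (q : 'Z_2) : Zmod n :=
  if q == 0 then x else - (x : 'I_n.-1.+1).

Fact neg_act_is_action : is_action [set: 'Z_2] neg_act.
Proof.
split=> [q x y|x q r _ _]; rewrite /neg_act; first by case: ifP => // _ /oppr_inj.
have -> : (q * r)%g = q + r by [].
case: q r => [[|[|//]] ?] [[|[|//]] ?]; rewrite /eq_op //=.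
by rewrite opprK.
Qed.

Canonical neg_action := Action neg_act_is_action.

Fact neg_action_is_groupAction : is_groupAction [set: Zmod n] neg_action.
Proof.
move=> q _; rewrite inE; apply/andP; split.
  by apply/subsetP => x _; rewrite inE.
apply/morphicP => x y _ _; rewrite !actpermE /= /neg_act.
by case: ifP => // _; apply: opprD.
Qed.

Canonical neg_groupAction := GroupAction neg_action_is_groupAction.

End NegationAction.

(* Main.v *)
From HB Require Import structures.
Require Import Defs.
From mathcomp Require Import all_boot all_fingroup all_algebra.
From mathcomp Require Import cyclic pgroup generic_quotient boolp zify.

(** Why [i_*] is bijective.  Write [G = Z/n], let [Q = Z/2] act by inversion,
let [m] be the odd part of [n], and let [e x = m x].  As [4] does not divide
[n], [2 m] is a multiple of [n], so every [m x] equals its own inverse: [e]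
commutes with the action and its image is fixed pointwise.  Moreover
[e x - x = (m - 1) x] is killed by [m], hence lies in [K = {x | m x = 0}], a
group of odd order.

The endomorphism [e] is the identity modulo [K].  Averaging over [K] the prism
operator of the resulting equivalence gives the explicit homotopy
[h [g_1|...|g_i] = sum_j (-1)^j sum_(k in K) [g_1|...|g_j|k|e g_(j+1)|...|e g_i]]
for which [d h + h d = #|K| (e_* - 1)]; see [bd_prismS] and [bd_prism0].  It is
[Q]-equivariant because [K] is stable under [Q] and [e] is [Q]-equivariant.

Besides, the norm [N = sum_q q] maps arbitrary chains to invariant ones and is
multiplication by [#|Q|] on invariant chains.

- Injectivity.  Let [z] be an invariant cycle and [z = d b] for some chain [b].
  Then [#|Q| z = d (N b)] and [#|K| z = d (#|K| e_* b - h z)] bound invariant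
  chains, since [e_* b] and [h z] are invariant.
- Surjectivity.  Let the class of [z] be invariant.  Then [#|Q| z] is
  homologous to the invariant cycle [N z], and [#|K| z] to the invariant cycle
  [#|K| e_* z].

As [#|K|] and [#|Q|] are coprime, a Bezout combination of the two facts
concludes in both cases ([homology_incl_inj], [homology_incl_surj]). *)

Set Implicit Arguments.
Unset Strict Implicit.
Unset Printing Implicit Defensive.

Import GRing.Theory.
Local Open Scope ring_scope.

(** * Complexes with a group action *)

Lemma homology_class_eq0 (X : chain_complex) i (z : cycles X i) :
  homology_class z = 0 <-> exists b : X i.+1, bd X i b = cycle_val z.
Proof.
rewrite -(raddf0 (@homology_class X i)).
split=> [/homology_class_eq|] [b bE]; last apply/homology_class_eq; exists b.
  by rewrite bE subr0.
by rewrite bE subr0.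
Qed.

Lemma bd_cycle (X : chain_complex) i (b : X i.+1) : bd X i b \in @is_cycle X i.
Proof. by case: i b => // i b; rewrite unfold_in /= bd_bd. Qed.

Section NormAndHomotopy.
Variables (Q : finGroupType) (X : chain_complex) (a : Q -> chain_map X X).
Hypothesis a_comp : forall p q i (c : X i), a p i (a q i c) = a (q * p)%g i c.

Definition norm_chain i (c : X i) : X i := \sum_q a q i c.

Fact norm_chain_invariant i (c : X i) :
  norm_chain c \in is_invariant (fun q => a q i).
Proof.
apply/forallP => p; apply/eqP; rewrite /norm_chain raddf_sum /=.
rewrite [RHS](reindex_inj (mulIg p)) /=.
by apply: eq_bigr => q _; rewrite a_comp.
Qed.

Lemma norm_chain_bd i (c : X i.+1) :
  bd X i (norm_chain c) = norm_chain (bd X i c).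
Proof. by rewrite raddf_sum; apply: eq_bigr => q _; rewrite chain_fun_bd. Qed.

Lemma norm_chain_fixed i (c : X i) :
  c \in is_invariant (fun q => a q i) -> norm_chain c = c *+ #|Q|.
Proof.
move=> /forallP cP; rewrite -sumr_const.
by apply: eq_bigr => q _; rewrite (eqP (cP q)).
Qed.

Lemma norm_chain_cycle i (c : X i) :
  c \in @is_cycle X i -> norm_chain c \in @is_cycle X i.
Proof.
case: i c => // i c; rewrite !unfold_in /= norm_chain_bd => /eqP->.
by rewrite /norm_chain big1 // => q _; rewrite raddf0.
Qed.

Lemma invariant_cycle i (c : X i)
    (cI : c \in is_invariant (fun q => a q i)) :
  c \in @is_cycle X i ->
  (Invariant cI : invariant_complex a i) \in @is_cycle (invariant_complex a) i.
Proof.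
by case: i c cI => // i c cI; rewrite !unfold_in /= => /eqP cE; apply/eqP/val_inj.
Qed.

(** When [c] represents an invariant class, this replaces [#|Q| c] by an invariant
    cycle: sum the homologies from [c] to its translates. *)
Lemma norm_chain_homologous i (c : X i) :
  (forall q, exists b, bd X i b = a q i c - c) ->
  exists b, bd X i b = norm_chain c - c *+ #|Q|.
Proof.
move=> /choice[b bE]; exists (\sum_q b q).
rewrite raddf_sum -sumr_const -sumrB.
by apply: eq_bigr => q _; rewrite bE.
Qed.

Variables (m : nat) (e : chain_map X X).
Variable h : forall i, {additive X i -> X i.+1}.
Hypothesis m_coprime : coprime m #|Q|.
Hypothesis m_gt0 : (0 < m)%N.
Hypothesis e_invariant : forall i (c : X i), e i c \in is_invariant (fun q => a q i).
Hypothesis h_equivariant : forall q i (c : X i), a q i.+1 (h i c) = h i (a q i c).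
Hypothesis bd_h : forall i (c : X i), c \in @is_cycle X i ->
  bd X i (h i c) = (e i c - c) *+ m.

Lemma bezout_split : exists u v : nat, (u * m = v * #|Q| + 1)%N.
Proof.
case: (egcdnP #|Q| m_gt0) => u v E _; exists u, v.
by rewrite E (eqP m_coprime).
Qed.

(** Both [m c] and [#|Q| c] bound invariant chains as soon as [c] is an invariant
    chain that bounds. *)
Lemma homology_incl_inj i : injective (homology_incl a i).
Proof.
apply/raddf_inj => x; rewrite -[x]reprK -/(homology_class _).
move: (repr x) => [[c cI] cP] /(congr1 (@invariant_val _ _ _)) /=.
rewrite homology_map_class => /homology_class_eq0[b] /=.
rewrite /incl_fun /= => bE; apply/homology_class_eq0 => /=.
have cC : c \in @is_cycle X i by rewrite -bE bd_cycle.
have [u [v uvE]] := bezout_split.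
(* The two bounding chains of the multiples of [c] by [m] and by [#|Q|],
   combined by Bezout. *)
have ebI : (e i.+1 b *+ m - h i c) *+ u - norm_chain b *+ v
    \in is_invariant (fun q => a q i.+1).
  apply: rpredB; last by rewrite rpredMn ?norm_chain_invariant.
  rewrite rpredMn // rpredB ?rpredMn //; apply/forallP => q.
  by rewrite h_equivariant (eqP (forallP cI q)).
exists (Invariant ebI); apply: val_inj => /=.
rewrite raddfB !raddfMn raddfB raddfMn /= bd_h // -chain_fun_bd bE.
rewrite norm_chain_bd bE (norm_chain_fixed cI).
rewrite -mulrnBl subKr ?mulNrn -!mulrnA [(m * u)%N]mulnC uvE [(_ * v)%N]mulnC.
by rewrite mulrnDr mulr1n addrAC subrr add0r.
Qed.

(** If [c] represents an invariant class, [m c] and [#|Q| c] are homologous to the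
    invariant cycles [m e(c)] and [norm_chain c]. *)
Lemma homology_incl_surj i (y : invariant_homology a i) :
  exists x, homology_incl a i x = y.
Proof.
case: y => y yI.
pose z := repr y; have zE : homology_class z = y by exact: reprK.
have aE q : exists b, bd X i b = a q i (cycle_val z) - cycle_val z.
  have := forallP yI q; rewrite -zE /= homology_map_class => /eqP.
  by move/homology_class_eq.
have [b bE] := norm_chain_homologous aE.
have [u [v uvE]] := bezout_split.
pose c := cycle_val z; have cP : c \in @is_cycle X i := cycle_valP z.
pose w := e i c *+ m *+ u - norm_chain c *+ v.
have wI : w \in is_invariant (fun q => a q i).
  by rewrite rpredB ?rpredMn ?norm_chain_invariant.
have wP : w \in @is_cycle X i.
  rewrite rpredB ?rpredMn ?norm_chain_cycle //.
  exact: (cycle_valP (Defs.cycle_map e z)).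
exists (homology_class (Cycle (invariant_cycle wI wP))).
apply: val_inj => /=; rewrite homology_map_class -zE.
apply/homology_class_eq => /=; rewrite /incl_fun /= -/c.
exists (h i c *+ u - b *+ v).
rewrite raddfB !raddfMn /= bd_h // bE -/c /w.
rewrite !mulNrn !mulrnBl -!mulrnA [(m * u)%N]mulnC uvE [(_ * v)%N]mulnC.
rewrite [c *+ (_ + 1)]mulrnDr mulr1n opprB addrACA opprD addrACA.
by rewrite -!addrA; congr (_ + _); rewrite addrA addrACA addNr add0r addrC.
Qed.

Lemma homology_incl_bij i : bijective (homology_incl a i).
Proof.
have [g gK] := choice (@homology_incl_surj i).
by exists g => // x; apply: (@homology_incl_inj i); rewrite gK.
Qed.

End NormAndHomotopy.

(** * The averaged prism operator on the bar complex *)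

(** The sign bookkeeping of a simplicial homotopy.  Here [A j l] stands for the
    [l]-th face of the [j]-th prism simplex, and [B j l] for the [j]-th prism
    simplex over the [l]-th face: the off-diagonal faces cancel against [B] and
    the two diagonals telescope. *)
Lemma prism_sum (V : zmodType) i (A B : nat -> nat -> V) :
  (forall j l, (l < j <= i)%N -> A j l = B j.-1 l) ->
  (forall j l, (j.+1 < l <= i.+1)%N -> A j l = B j l.-1) ->
  (forall j, (j < i)%N -> A j j.+1 = A j.+1 j.+1) ->
  \sum_(j < i.+1) \sum_(l < i.+2) A j l *~ ((-1) ^+ j * (-1) ^+ l) =
  A 0 0 - A i i.+1
  - \sum_(j < i) \sum_(l < i.+1) B j l *~ ((-1) ^+ j * (-1) ^+ l).
Proof.
move=> lowE upE diagE.
pose s j l : int := (-1) ^+ j * (-1) ^+ l.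
have sS j l : s j.+1 l = - s j l by rewrite /s exprS mulN1r mulNr.
have Ss j l : s j l.+1 = - s j l by rewrite /s exprS mulN1r mulrN.
have sdiag j : s j j = 1 by rewrite /s -exprD -signr_odd addnn odd_double.
have rowE j : (j <= i)%N -> \sum_(l < i.+2) A j l *~ s j l =
    \sum_(0 <= l < j) A j l *~ s j l + (A j j - A j j.+1)
    + \sum_(j.+2 <= l < i.+2) A j l *~ s j l.
  move=> ji; rewrite -(big_mkord predT (fun l => A j l *~ s j l)).
  rewrite (@big_cat_nat _ _ _ j) //=; last lia.
  have [ji1 ji2] : (j < i.+2)%N /\ (j.+1 < i.+2)%N by lia.
  rewrite (big_ltn ji1) (big_ltn ji2).
  by rewrite Ss sdiag mulrNz mulr1z !addrA.
(* The part below the diagonal is empty for [j = 0], the one above for [j = i];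
   dropping these rows makes both index ranges match those of [B]. *)
rewrite (eq_bigr _ (fun (j : 'I_i.+1) _ => rowE j (ltn_ord j))) !big_split /=.
rewrite big_ord_recl big_geq // add0r.
rewrite [X in _ + X]big_ord_recr /= big_geq // addr0.
have -> : \sum_(j < i.+1) A j j + \sum_(j < i.+1) - A j j.+1 = A 0 0 - A i i.+1.
  rewrite sumrN big_ord_recl big_ord_recr /= opprD addrA; congr (_ - _).
  rewrite -addrA -sumrB big1 ?addr0 // => j _.
  by rewrite diagE ?subrr.
rewrite addrAC addrC; congr (_ + _).
rewrite -big_split -sumrN; apply: eq_bigr => j _ /=.
rewrite -(big_mkord predT (fun l => B j l *~ s j l)).
have ji : (j < i.+1)%N by apply: ltnW; apply: (ltn_ord j).
rewrite (big_cat_nat (leq0n j.+1) ji) /= opprD.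
rewrite -!sumrN; congr (_ + _).
  apply: eq_big_nat => l; rewrite /bump /= add1n => lj.
  by rewrite lowE ?sS ?mulrNz //; have := ltn_ord j; lia.
rewrite big_add1 /=; apply: eq_big_nat => l lj.
by rewrite upE ?Ss ?mulrNz //; have := ltn_ord j; lia.
Qed.

Section BarMap.
Variables (gT : finGroupType) (e : gT -> gT).
Hypothesis eM : {morph e : x y / (x * y)%g}.

Definition map_bar_fun i : {additive bar_complex gT i -> bar_complex gT i} :=
  free_lift (fun t : i.-tuple gT => free_gen [tuple of map e t]).

Lemma morph1 : e 1%g = 1%g.
Proof. by apply: (mulgI (e 1%g)); rewrite -eM !mulg1. Qed.

Lemma nth_map_morph (s : seq gT) p : nth 1%g (map e s) p = e (nth 1%g s p).
Proof.
case: (ltnP p (size s)) => ps; first exact: nth_map.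
by rewrite !nth_default ?size_map ?morph1.
Qed.

Lemma bar_face_map i (t : i.+1.-tuple gT) k :
  bar_face [tuple of map e t] k = [tuple of map e (bar_face t k)].
Proof.
apply: eq_from_tnth => j; rewrite tnth_map !tnth_mktuple !nth_map_morph.
by do 2?case: ifP => _ //; rewrite eM.
Qed.

Fact map_bar_bd i (c : bar_complex gT i.+1) :
  map_bar_fun i (bd (bar_complex gT) i c) =
  bd (bar_complex gT) i (map_bar_fun i.+1 c).
Proof.
apply: (@free_ext _ _
  (map_bar_fun i \o bd (bar_complex gT) i : {additive _ -> _})
  (bd (bar_complex gT) i \o map_bar_fun i.+1 : {additive _ -> _})) => t /=.
rewrite /bar_bd /map_bar_fun !free_lift_gen raddf_sum.
apply: eq_bigr => k _.
by rewrite raddfMz free_lift_gen bar_face_map.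
Qed.

Definition map_bar : chain_map (bar_complex gT) (bar_complex gT) :=
  ChainMap map_bar_bd.

(** The simplex [[t_0|...|t_(j-1)|k|e t_j|...|e t_(i-1)]]. *)
Definition prism_simplex i (j : nat) (k : gT) (t : i.-tuple gT) : i.+1.-tuple gT :=
  [tuple if (p < j)%N then nth 1%g t p
         else if p == j :> nat then k else e (nth 1%g t p.-1) | p < i.+1].

Lemma nth_prism_simplex i j k (t : i.-tuple gT) p : (p < i.+1)%N ->
  nth 1%g (prism_simplex j k t) p =
    if (p < j)%N then nth 1%g t p
    else if p == j then k else e (nth 1%g t p.-1).
Proof. by move=> pi; rewrite -(tnth_nth _ _ (Ordinal pi)) tnth_mktuple. Qed.

Variable K : {group gT}.

(** Summing over all [k] in [K] makes the chain insensitive to translating the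
    inserted entry by an element of [K]; for a single [k] the diagonal faces would
    not cancel. *)
Definition prism_gen i (t : i.-tuple gT) : bar_complex gT i.+1 :=
  \sum_(j < i.+1) (\sum_(k in K) free_gen (prism_simplex j k t)) *~ (-1) ^+ j.

Definition prism i : {additive bar_complex gT i -> bar_complex gT i.+1} :=
  free_lift (@prism_gen i).

Lemma bar_face_prism_low i j k (t : i.+1.-tuple gT) l : (l < j <= i.+1)%N ->
  bar_face (prism_simplex j k t) l = prism_simplex j.-1 k (bar_face t l).
Proof.
move=> lj; apply: eq_from_tnth => p; rewrite !tnth_mktuple.
have pi := ltn_ord p; rewrite !nth_prism_simplex; try lia.
case: j lj => // j lj /=.
case: (ltngtP p j) => pj.
- rewrite nth_bar_face; last lia.
  have [pj1 pj2] : (p < j.+1)%N /\ (p.+1 < j.+1)%N by lia.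
  by rewrite pj1 pj2.
- have -> : (p.+1 < l)%N = false by lia.
  have -> : (p.+1 == l)%N = false by lia.
  rewrite nth_bar_face; last lia.
  have -> : (p.-1.+1 < l)%N = false by lia.
  have -> : (p.-1.+1 == l)%N = false by lia.
  have -> : (p.+1 < j.+1)%N = false by lia.
  have -> : (p.+1 == j.+1)%N = false by lia.
  by rewrite prednK //; lia.
- have -> : (p.+1 < l)%N = false by lia.
  have -> : (p.+1 == l)%N = false by lia.
  by rewrite pj ltnn eqxx.
Qed.

Lemma bar_face_prism_high i j k (t : i.+1.-tuple gT) l : (j.+1 < l <= i.+2)%N ->
  bar_face (prism_simplex j k t) l = prism_simplex j k (bar_face t l.-1).
Proof.
case: l => // l lj; apply: eq_from_tnth => p; rewrite !tnth_mktuple /=.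
have pi := ltn_ord p; rewrite !nth_prism_simplex; try lia.
rewrite ltnS eqSS; case: (ltngtP p j) => pj.
- have -> : (p < l)%N by lia.
  rewrite nth_bar_face; last lia.
  by have -> : (p.+1 < l)%N by lia.
- case: p pi pj => [[|p] //= ltp] _ jp; rewrite ltnS in jp.
  rewrite nth_bar_face //; have -> : (p.+2 < j)%N = false by lia.
  have -> : (p.+2 == j)%N = false by lia.
  by do 2?case: ifP => _ //; rewrite eM.
- by have -> : (p < l)%N by lia.
Qed.

Lemma bar_face_prism_first i k (t : i.-tuple gT) :
  bar_face (prism_simplex 0 k t) 0 = [tuple of map e t].
Proof.
apply: eq_from_tnth => p; rewrite tnth_map tnth_mktuple.
have pi : (p.+1 < i.+1)%N := ltn_ord p.
by rewrite (nth_prism_simplex _ _ _ pi) /= (tnth_nth 1%g).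
Qed.

Lemma bar_face_prism_last i k (t : i.-tuple gT) :
  bar_face (prism_simplex i k t) i.+1 = t.
Proof.
apply: eq_from_tnth => p; rewrite tnth_mktuple (tnth_nth 1%g).
have pi := ltn_ord p; have pi' : (p < i.+1)%N := ltnW pi.
by rewrite ltnS pi (nth_prism_simplex _ _ _ pi') pi.
Qed.

Hypothesis nKG : forall x, x \in 'N(K)%g.
Hypothesis eK : forall x, (x^-1 * e x)%g \in K.

(** With [x = t_j], the two faces have entries [k * e x] and [x * k'] in position
    [j], and agree elsewhere; [k' = x^-1 * k * e x = k ^ x * (x^-1 * e x)] runs
    over [K] as [k] does. *)
Lemma sum_bar_face_prism_diag i j (t : i.-tuple gT) : (j < i)%N ->
  \sum_(k in K) free_gen (bar_face (prism_simplex j k t) j.+1) =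
  \sum_(k in K) free_gen (bar_face (prism_simplex j.+1 k t) j.+1).
Proof.
move=> ji; pose x := nth 1%g t j.
have phi_inj : injective (fun k => x^-1 * k * e x)%g.
  by move=> k k' /mulIg/mulgI.
rewrite [RHS](reindex_inj phi_inj) /=; apply: eq_big => [k|k _].
  have -> : (x^-1 * k * e x = k ^ x * (x^-1 * e x))%g by rewrite conjgE !mulgA mulgK.
  by rewrite groupMr ?memJ_norm.
congr free_gen; apply: eq_from_tnth => p; rewrite !tnth_mktuple.
have pi := ltn_ord p; rewrite !nth_prism_simplex; try lia.
rewrite !ltnS !eqSS; case: (ltngtP p j) => pj.
- by [].
- have -> : (p.+1 < j)%N = false by lia.
  by have -> : (p.+1 == j)%N = false by lia.
- have -> : (p.+1 < j)%N = false by lia.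
  have -> : (p.+1 == j)%N = false by lia.
  by rewrite /= pj !mulgA mulgV mul1g.
Qed.

Lemma bd_prism_gen i (t : i.-tuple gT) :
  bd (bar_complex gT) i (prism i (free_gen t)) =
  \sum_(j < i.+1) \sum_(l < i.+2)
    (\sum_(k in K) free_gen (bar_face (prism_simplex j k t) l))
      *~ ((-1) ^+ j * (-1) ^+ l).
Proof.
rewrite /prism free_lift_gen /prism_gen raddf_sum; apply: eq_bigr => j _.
rewrite raddfMz raddf_sum /=.
under eq_bigr => k _ do rewrite /bar_bd free_lift_gen /bar_bd_gen.
rewrite exchange_big /= mulrz_suml; apply: eq_bigr => l _.
by rewrite [_ * _ in RHS]mulrC mulrzA -mulrz_suml.
Qed.

Lemma prism_bd_gen i (t : i.+1.-tuple gT) :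
  prism i (bd (bar_complex gT) i (free_gen t)) =
  \sum_(j < i.+1) \sum_(l < i.+2)
    (\sum_(k in K) free_gen (prism_simplex j k (bar_face t l)))
      *~ ((-1) ^+ j * (-1) ^+ l).
Proof.
rewrite /= /bar_bd free_lift_gen /bar_bd_gen raddf_sum.
rewrite [RHS]exchange_big /=; apply: eq_bigr => l _.
rewrite raddfMz /prism free_lift_gen /prism_gen mulrz_suml.
by apply: eq_bigr => j _; rewrite mulrzA.
Qed.

Definition scaled_defect i (c : bar_complex gT i) : bar_complex gT i :=
  (map_bar i c - c) *+ #|K|.

Fact scaled_defect_zmod_morphism i : zmod_morphism (@scaled_defect i).
Proof.
move=> c c'; rewrite /scaled_defect raddfB -mulrnBl; congr (_ *+ _).
by rewrite !opprD !opprK addrACA.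
Qed.
HB.instance Definition _ i := GRing.isZmodMorphism.Build
  (bar_complex gT i) (bar_complex gT i) (@scaled_defect i)
  (@scaled_defect_zmod_morphism i).

(** [B] is a parameter in order to cover [i = 0], where there are no faces to
    build it from and its sum is empty. *)
Lemma bd_prism_boundary i (t : i.-tuple gT) (B : nat -> nat -> bar_complex gT i) :
  (forall j l, (l < j <= i)%N ->
    \sum_(k in K) free_gen (bar_face (prism_simplex j k t) l) = B j.-1 l) ->
  (forall j l, (j.+1 < l <= i.+1)%N ->
    \sum_(k in K) free_gen (bar_face (prism_simplex j k t) l) = B j l.-1) ->
  bd (bar_complex gT) i (prism i (free_gen t)) =
  scaled_defect (free_gen t)
  - \sum_(j < i) \sum_(l < i.+1) B j l *~ ((-1) ^+ j * (-1) ^+ l).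
Proof.
move=> lowE highE; rewrite bd_prism_gen.
pose A j l := \sum_(k in K) free_gen (bar_face (prism_simplex j k t) l).
rewrite (@prism_sum _ i A B) //; last by move=> j ji; apply: sum_bar_face_prism_diag.
congr (_ - _); rewrite /scaled_defect mulrnBl /A -!sumr_const /= /map_bar_fun free_lift_gen.
congr (_ - _); apply: eq_bigr => k _; first by rewrite bar_face_prism_first.
by rewrite bar_face_prism_last.
Qed.

Lemma bd_prism0 (c : bar_complex gT 0) :
  bd (bar_complex gT) 0 (prism 0 c) = scaled_defect c.
Proof.
pose f : {additive _ -> _} := bd (bar_complex gT) 0 \o prism 0.
apply: (@free_ext _ _ f (@scaled_defect 0)) => t.
rewrite /f /= (@bd_prism_boundary _ t (fun _ _ => 0)) ?big_ord0 ?subr0 //; lia.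
Qed.

Lemma bd_prismS i (c : bar_complex gT i.+1) :
  bd (bar_complex gT) i.+1 (prism i.+1 c) =
  scaled_defect c - prism i (bd (bar_complex gT) i c).
Proof.
pose f : {additive _ -> _} := bd (bar_complex gT) i.+1 \o prism i.+1.
pose g : {additive _ -> _} := @scaled_defect i.+1 \- (prism i \o bd (bar_complex gT) i).
apply: (@free_ext _ _ f g) => t; rewrite /f /g /=.
rewrite (prism_bd_gen t).
pose B j l := \sum_(k in K) free_gen (prism_simplex j k (bar_face t l)).
apply: (bd_prism_boundary (B := B)) => j l jl; apply: eq_bigr => k _.
  by rewrite bar_face_prism_low.
by rewrite bar_face_prism_high.
Qed.

Lemma bd_prism i (c : bar_complex gT i) : c \in @is_cycle (bar_complex gT) i ->
  bd (bar_complex gT) i (prism i c) = (map_bar i c - c) *+ #|K|.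
Proof.
case: i c => [|i] c; first by rewrite bd_prism0.
by rewrite unfold_in bd_prismS => /eqP->; rewrite raddf0 subr0.
Qed.

End BarMap.

(** * Coprime actions *)

Section CoprimeAction.
Variables (gT qT : finGroupType) (to : groupAction [set: qT] [set: gT]).
Variables (e : gT -> gT) (K : {group gT}).
Hypothesis eM : {morph e : x y / (x * y)%g}.
Hypothesis e_fixed : forall q x, to (e x) q = e x.
Hypothesis e_act : forall q x, e (to x q) = e x.
Hypothesis K_act : forall q k, (to k q \in K) = (k \in K).
Hypothesis nKG : forall x, x \in 'N(K)%g.
Hypothesis eK : forall x, (x^-1 * e x)%g \in K.

Lemma bar_act_comp p q i (c : bar_complex gT i) :
  bar_act to p i (bar_act to q i c) = bar_act to (q * p)%g i c.
Proof.
pose f : {additive _ -> _} := bar_act to p i \o bar_act to q i.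
apply: (@free_ext _ _ f (bar_act to (q * p)%g i)) => t.
rewrite /f /= /bar_act_fun !free_lift_gen; congr free_gen.
by apply: eq_from_tnth => j; rewrite !tnth_map actMin ?inE.
Qed.

Lemma map_bar_invariant i (c : bar_complex gT i) :
  map_bar eM i c \in is_invariant (fun q => bar_act to q i).
Proof.
apply/forallP => q; apply/eqP.
pose f : {additive _ -> _} := bar_act to q i \o map_bar eM i.
apply: (@free_ext _ _ f (map_bar eM i)) => t.
rewrite /f /= /map_bar_fun /bar_act_fun !free_lift_gen; congr free_gen.
by apply: eq_from_tnth => j; rewrite !tnth_map e_fixed.
Qed.

Lemma prism_equivariant q i (c : bar_complex gT i) :
  bar_act to q i.+1 (prism e K i c) = prism e K i (bar_act to q i c).
Proof.
pose f : {additive _ -> _} := bar_act to q i.+1 \o prism e K i.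
pose g : {additive _ -> _} := prism e K i \o bar_act to q i.
apply: (@free_ext _ _ f g) => t.
rewrite /f /g /= /prism /bar_act_fun !free_lift_gen /prism_gen raddf_sum.
apply: eq_bigr => j _; rewrite raddfMz; congr (_ *~ _).
rewrite raddf_sum [RHS](reindex_inj (act_inj to q)) /=.
apply: eq_big => [k|k _]; first by rewrite K_act.
rewrite free_lift_gen; congr free_gen.
apply: eq_from_tnth => p; rewrite tnth_map !tnth_mktuple.
have to1 : to 1%g q = 1%g by apply: gact1; rewrite inE.
have nthE r : nth 1%g (map (to^~ q) t) r = to (nth 1%g t r) q.
  case: (ltnP r (size t)) => rt; first exact: nth_map.
  by rewrite !nth_default ?size_map ?to1.
rewrite !nthE; case: ifP => // _; case: ifP => // _.
by rewrite e_fixed e_act.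
Qed.

(** The chain map induced by [e] takes values in invariant chains, and the averaged
    prism makes it homotopic to the identity up to the factor [#|K|]; coprimality
    lets the norm, which costs a factor [#|qT|], account for the rest. *)
Theorem bar_incl_star_bij i : coprime #|K| #|qT| -> bijective (bar_incl_star to i).
Proof.
move=> coK.
exact: (homology_incl_bij bar_act_comp coK (cardG_gt0 K) map_bar_invariant
  prism_equivariant (fun i => @bd_prism _ _ eM K nKG eK i)).
Qed.

End CoprimeAction.

(** The criterion applies with [e x = x ^+ m] for [m] the odd part of the order of
    [G]: as [x ^+ m.*2 = 1], inversion fixes the [m]-th powers, and [x ^+ m.-1] is
    killed by [m] because [m.-1] is even. *)
Theorem bar_incl_star_inversion_bij (gT qT : finGroupType)
    (to : groupAction [set: qT] [set: gT]) i :
  abelian [set: gT] -> ~~ (4 %| #|gT|)%N -> #|qT| = 2%N ->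
  (forall q, (forall x, to x q = x) \/ (forall x, to x q = x^-1)%g) ->
  bijective (bar_incl_star to i).
Proof.
move=> abG n4 q2 toE; pose m := (#|gT|`_2^')%N.
have comm (x y : gT) : commute x y by apply: (centsP abG); rewrite inE.
have m_odd : odd m by rewrite odd_2'nat part_pnat.
have dvd_2m : (#|gT| %| m.*2)%N.
  have gT_gt0 : (0 < #|gT|)%N by apply/card_gt0P; exists 1%g.
  rewrite -(partnC 2%N gT_gt0) -muln2 mulnC dvdn_pmul2l // p_part.
  by rewrite (dvdn_exp2l 2%N (n := 1)) // -ltnS ltnNge -pfactor_dvdn.
have x2m (x : gT) : (x ^+ m.*2 = 1)%g.
  apply/eqP; rewrite -order_dvdn; apply: dvdn_trans dvd_2m.
  by rewrite -cardsT order_dvdG ?inE.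
pose e (x : gT) := (x ^+ m)%g.
have eM : {morph e : x y / (x * y)%g} by move=> x y; rewrite /e expgMn.
have eV x : (e x)^-1%g = e x.
  by apply/eqP; rewrite eq_invg_mul /e -expgD addnn x2m.
pose A := [set x | e x == 1%g].
have gA : group_set A.
  apply/group_setP; split=> [|x y]; rewrite !inE /e ?expg1n //.
  by move=> /eqP xE /eqP yE; rewrite (expgMn _ (comm x y)) xE yE mulg1.
apply: (@bar_incl_star_bij _ _ to e (Group gA) eM) => [q x|q x|q k|x|x|].
- by case: (toE q) => ->.
- by case: (toE q) => -> //; rewrite /e expgVn eV.
- by case: (toE q) => -> //; apply: groupV.
- by apply: (subsetP (sub_abelian_norm abG (subsetT _))); rewrite inE.
- rewrite inE /e -[in X in (x^-1 * x ^+ X)%g](odd_double_half m) m_odd expgS mulKg.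
  by rewrite -expgM -doubleMl mulnC doubleMl expgM x2m expg1n.
- rewrite q2 coprimen2; apply: contraT => K_even.
  have [x] : {x | x \in Group gA & #[x]%g = 2%N} by apply: Cauchy; rewrite ?dvdn2.
  by rewrite inE -order_dvdn => /[swap] ->; rewrite dvdn2 m_odd.
Qed.

Theorem theorem5p1 (n : nat) (n_gt0 : (0 < n)%N) (n_mod4 : (n <> 0 %[mod 4])%N) :
  forall i : nat, bijective (bar_incl_star (neg_groupAction n) i).
Proof.
move=> i; apply: bar_incl_star_inversion_bij; last first.
- by move=> q; case E: (q == 0); [left | right] => x; rewrite /= /neg_act E.
- by rewrite card_ord.
- by rewrite card_ord prednK //; apply/negP => /eqP n0; apply: n_mod4; rewrite n0.
by apply/centsP => x _ y _; apply: addrC.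
Qed.
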